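(* Let $(x_1,x_2,y,z,w)$ satisfy $x_1,x_2,y,w\in\mathbb{R}$, $z\in\{0,1\}$ and $$q_2x_2^2+ry^2+z\le w,\quad x_2=ax_1+by+cz,\quad gz\le y\le hz,\quad \ell_1\le x_1\le u_1,\quad \ell_2\le x_2\le u_2.$$ Put $\ell_a=\min\{a\ell_1,au_1\}$ and $u_a=\max\{a\ell_1,au_1\}$. 1. If at least one of the two conditions $\ell_a\le u_2$ and $\ell_2\le u_a$ is violated, then $z=1$. 2. Otherwise (that is, if $\ell_a\le u_2$ and $\ell_2\le u_a$), all six of the following inequalities hold: $$\ell_a(1-z)\le x_2-\ell_2z,$$ $$x_2-u_2z\le u_a(1-z),$$ $$x_2\ge by+cz+\ell_az+\ell_2(1-z),$$ $$x_2\le by+cz+u_az+u_2(1-z),$$ $$u_2z\ge by+cz+\ell_az,$$ $$by+cz+u_az\ge\ell_2z.$$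
   Context: The data are real numbers $a,b,c,g,h,\ell_1,u_1,\ell_2,u_2$ and $q_2,r\ge 0$. The constraints describe the feasible set of the epigraph form of a single-period hybrid control problem with one-dimensional state, control and binary mode variables. *)

(* Defs.v *)
From Stdlib Require Export Reals.

(* Main.v *)
Require Import Defs.
From Stdlib Require Import Reals.
From Stdlib Require Import Lra.
Open Scope R_scope.

(** Since [la] and [ua] are the extreme values of [t => a * t] over [[l1, u1]]
    ([scale_between]), the mode-free state [a * x1] always lies in [[la, ua]].
    In mode [z = 0] the bounds on [y] collapse to [y = 0], so [x2] is [a * x1]
    itself and lies in both [[la, ua]] and [[l2, u2]]; if these intervals are
    disjoint, only [z = 1] remains.  Each of the six inequalities is a
    disjunctive bound interpolating between the modes: at each value of [z] it
    reduces to [la <= a * x1 <= ua], to [l2 <= x2 <= u2], to the sum of a bound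
    of each kind, or to [0 <= 0]. *)

(** Whatever the sign of [a], multiplication by [a] is monotone or antitone, so
    the extremes over an interval are attained at its endpoints. *)
Lemma scale_between (a l u x : R) :
  l <= x <= u -> Rmin (a * l) (a * u) <= a * x <= Rmax (a * l) (a * u).
Proof.
  intros [Hl Hu].
  pose proof (Rmin_l (a * l) (a * u)); pose proof (Rmin_r (a * l) (a * u)).
  pose proof (Rmax_l (a * l) (a * u)); pose proof (Rmax_r (a * l) (a * u)).
  destruct (Rle_or_lt 0 a) as [Ha | Ha].
  - pose proof (Rmult_le_compat_l a l x Ha Hl).
    pose proof (Rmult_le_compat_l a x u Ha Hu).
    lra.
  - pose proof (Rmult_le_compat_neg_l a l x (Rlt_le _ _ Ha) Hl).
    pose proof (Rmult_le_compat_neg_l a x u (Rlt_le _ _ Ha) Hu).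
    lra.
Qed.

Theorem proposition4
  (a b c g h l1 u1 l2 u2 q2 r : R) (hq2 : 0 <= q2) (hr : 0 <= r)
  (x1 x2 y z w : R)
  (hz : z = 0 \/ z = 1)
  (hcost : q2 * x2 ^ 2 + r * y ^ 2 + z <= w)
  (hdyn : x2 = a * x1 + b * y + c * z)
  (hy : g * z <= y <= h * z)
  (hx1 : l1 <= x1 <= u1)
  (hx2 : l2 <= x2 <= u2) :
  let la := Rmin (a * l1) (a * u1) in
  let ua := Rmax (a * l1) (a * u1) in
  (~ (la <= u2) \/ ~ (l2 <= ua) -> z = 1) /\
  (la <= u2 /\ l2 <= ua ->
     la * (1 - z) <= x2 - l2 * z /\
     x2 - u2 * z <= ua * (1 - z) /\
     x2 >= b * y + c * z + la * z + l2 * (1 - z) /\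
     x2 <= b * y + c * z + ua * z + u2 * (1 - z) /\
     u2 * z >= b * y + c * z + la * z /\
     b * y + c * z + ua * z >= l2 * z).
Proof.
  intros la ua.
  assert (Hax : la <= a * x1 <= ua) by exact (scale_between a l1 u1 x1 hx1).
  clearbody la ua.
  destruct hz as [-> | ->].
  - assert (y = 0) as -> by lra.
    split; [intros [H | H]; exfalso |]; lra.
  - split; [reflexivity |].
    intros _; lra.
Qed.
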